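(* For $\psi\in[0,\pi]$ and $n\in\mathbb N_0$ let $\mu_n(\psi)=\sqrt{\sum_{j=-n}^n\frac{8\pi^2}{2n+1}|\widetilde P_n^j(0)|^2 s_j(\psi)^2}$. Then for odd $n=2m-1$, \[ \lim_{m\to\infty}\frac{4m-1}{4}\,\mu_{2m-1}(\psi)^2=\begin{cases}4\pi\psi,&\psi\in[0,\frac\pi2],\\ 4\pi^2-4\pi\psi,&\psi\in[\frac\pi2,\pi],\end{cases} \] and for even $n=2m$, \[ \lim_{m\to\infty}\frac{4m+1}{4}\,\mu_{2m}(\psi)^2=\begin{cases}4\pi\psi,&\psi\in[0,\frac\pi2],\\ 12\pi\psi-4\pi^2,&\psi\in[\frac\pi2,\pi].\end{cases} \]
   Context: Associated Legendre functions $P_n^k(t)=\frac{(-1)^k}{2^n n!}(1-t^2)^{k/2}\frac{d^{n+k}}{dt^{n+k}}(t^2-1)^n$ for $k=0,\dots,n$; normalized $\widetilde P_n^k=\sqrt{\frac{2n+1}{4\pi}\frac{(n-k)!}{(n+k)!}}P_n^k$ and $\widetilde P_n^{-k}=(-1)^k\widetilde P_n^k$. Let $s_0(\psi)=2\psi$ and $s_j(\psi)=\frac{2\sin(j\psi)}{j}$ for $j\ne0$. (For $\psi\in(0,\pi)$, $\mu_n(\psi)$ are the singular values of the fixed-length great-circle-arc transform $f\mapsto\int_{-\psi}^{\psi}f(Q^{-1}(\cos\varphi,\sin\varphi,0)^\top)\,d\varphi$, $Q\in\mathrm{SO}(3)$.) *)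

(* Defs.v *)
From HB Require Import structures.
From mathcomp Require Import all_boot all_order all_algebra.
From mathcomp Require Import all_classical all_reals all_analysis.
Set Implicit Arguments. Unset Strict Implicit. Unset Printing Implicit Defensive.
Import Order.TTheory GRing.Theory Num.Theory.
Local Open Scope ring_scope.

Section Defs.
Variable R : realType.

Definition legendreP (n k : nat) (t : R) : R :=
  (-1) ^+ k / (2 ^+ n * (n`!)%:R) * Num.sqrt (1 - t ^+ 2) ^+ k
  * ((('X ^+ 2 - 1 : {poly R}) ^+ n)^`(n + k)).[t].

Definition legendrePn_pos (n k : nat) (t : R) : R :=
  Num.sqrt ((2 * n%:R + 1) / (4 * pi) * ((n - k)`!)%:R / ((n + k)`!)%:R)
  * legendreP n k t.

Definition legendrePn (n : nat) (j : int) (t : R) : R :=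
  if (j < 0)%R then (-1) ^+ `|j|%N * legendrePn_pos n `|j|%N t
  else legendrePn_pos n `|j|%N t.

Definition s_fun (j : int) (psi : R) : R :=
  if j == 0 then 2 * psi else 2 * sin (j%:~R * psi) / j%:~R.

Definition mu (n : nat) (psi : R) : R :=
  Num.sqrt (\sum_(0 <= i < (2 * n).+1)
    let j : int := (i%:Z - n%:Z)%R in
    8 * pi ^+ 2 / (2 * n%:R + 1) * `|legendrePn n j 0| ^+ 2 * s_fun j psi ^+ 2).

End Defs.

(* Main.v *)
(* At t = 0 the associated Legendre functions are explicit: with
   c_a = C(2a, a) / 4^a, the squared normalized value is
   (2n+1)/(4 pi) * c_a * c_b when n - |j| = 2a and n + |j| = 2b, and 0 when
   n + j is odd.  Hence (2n+1)/4 * mu_n^2 is a sum of weights times s_j^2, and by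
   the Wallis asymptotics c_a^2 (2a+1) --> 2/pi each weight with j = n (mod 2) tends
   to 2.  The weights are O(sqrt j) uniformly in n, so the j-th term is
   O(j^(-3/2)) and limit and sum may be exchanged.
     The limiting series reduce to the sum of sin^2(k t) / k^2, which equals
   t (pi - t) / 2 on [0, pi].  This is again a dominated limit, of the finite identity
   sum_(k=1..M) sin^2(x pi k / N) / sin^2(pi k / N) = x (N - x) / 2, N = 2M+1
   (summation of the Fejer kernel), with x / N --> t / pi. *)

Require Import Defs.
From HB Require Import structures.
From mathcomp Require Import all_boot all_order all_algebra.
From mathcomp Require Import all_classical all_reals all_analysis.
From mathcomp Require Import ring lra zify.
Import Order.TTheory GRing.Theory Num.Theory.
Import numFieldNormedType.Exports.
Local Open Scope ring_scope.
Local Open Scope classical_set_scope.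

(** * Preliminaries: dominated convergence for sums of varying length *)

Lemma natr_doubleS (R : nzRingType) (n : nat) : n.*2.+1%:R = 2 * n%:R + 1 :> R.
Proof. by rewrite -addn1 natrD -mul2n natrM. Qed.

(** Tannery's theorem with the majorant in telescoped form: the terms from [K] on add up to at most
    [u K], and the finitely many terms below [K] tend to 0 one by one. *)
Lemma cvg_sum_telescoping_dominated (R : realType) (h : nat -> nat -> R)
    (u : nat -> R) (L : nat -> nat) :
  (forall k, 0 <= u k) -> u @ \oo --> (0 : R) ->
  (forall m k, (k < L m)%N -> `|h m k| <= u k - u k.+1) ->
  (forall k, h m k @[m --> \oo] --> (0 : R)) ->
  \sum_(k < L m) h m k @[m --> \oo] --> (0 : R).
Proof.
move=> u0 ucv hu hcv; apply/cvgr0Pnorm_lt => e e0.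
have e20 : 0 < e / 2 by rewrite divr_gt0.
have [K _ uK] := (cvgr0Pnorm_lt _).1 ucv (e / 2) e20.
have {uK} uK : u K < e / 2 by apply: le_lt_trans (ler_norm _) (uK K (leqnn K)).
have hK : \sum_(k < K) `|h m k| @[m --> \oo] --> (0 : R).
  rewrite -[X in _ --> X](big1_eq (op := +%R) (index_enum 'I_K) xpredT).
  apply: cvg_big => [|k _]; first exact: add_continuous.
  exact/norm_cvg0P/hcv.
apply: filterS ((cvgr0Pnorm_lt _).1 hK (e / 2) e20) => m.
rewrite ger0_norm ?sumr_ge0// => hm.
apply: le_lt_trans (ler_norm_sum _ _ _) _; rewrite -(big_mkord xpredT (fun k => `|h m k|)).
have [LK|KL] := leqP (L m) K.
  apply: (@le_lt_trans _ _ (\sum_(k < K) `|h m k|)); last by lra.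
  by rewrite -(big_mkord xpredT (fun k => `|h m k|)) (big_cat_nat (leq0n _) LK)//= lerDl sumr_ge0.
rewrite (big_cat_nat (leq0n _) (ltnW KL))//= big_mkord.
suff : \sum_(K <= k < L m) `|h m k| <= u K by lra.
apply: (@le_trans _ _ (\sum_(K <= k < L m) (u k - u k.+1))).
  rewrite big_nat_cond [leRHS]big_nat_cond; apply: ler_sum => k.
  by rewrite andbT => /andP[_ kL]; exact: hu.
under eq_bigr do rewrite -opprB.
by rewrite sumrN telescope_sumr ?(ltnW KL)// opprB lerBlDr lerDl.
Qed.

(** * Wallis integrals and the asymptotics of the central binomial coefficients *)

(** The antiderivative of [sin x ^+ n] that vanishes at 0, given by the reduction formula from
    integration by parts. Its value at [pi / 2] is the Wallis integral, obtained without integration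
    theory. *)
Fixpoint sin_int {R : realType} (n : nat) (x : R) : R :=
  match n with
  | 0 => x
  | 1 => 1 - cos x
  | (n'.+1 as n1).+1 =>
      (n1%:R * sin_int n' x - sin x ^+ n1 * cos x) / n1.+1%:R
  end.

Lemma is_derive_sin_int (R : realType) (n : nat) (x : R) :
  is_derive x 1 (sin_int n) (sin x ^+ n).
Proof.
elim/ltn_ind: n => -[|[|n]] IH; first by rewrite expr0; exact: is_derive_id.
  rewrite expr1 (_ : sin_int 1 = (fun y => 1 - cos y))//; apply: is_derive_eq.
  by rewrite add0r opprK mul1r.
have D0 := IH n (ltnW (ltnSn _)).
rewrite (_ : sin_int n.+2 =
  (fun y => (n.+1%:R * sin_int n y - sin y ^+ n.+1 * cos y) / n.+2%:R))//.
have D1 : is_derive x 1 (fun y : R => sin y ^+ n.+1) (n.+1%:R * sin x ^+ n * cos x).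
  have -> : (fun y : R => sin y ^+ n.+1) = (@sin R) ^+ n.+1.
    by apply/funext => y; rewrite fctE.
  by apply: is_derive_eq.
apply: is_derive_eq; rewrite /GRing.scale/=.
have cs : cos x ^+ 2 = 1 - sin x ^+ 2 by rewrite cos2sin2.
rewrite mulr0 mulr0 add0r.
have -> : cos x * (n.+1%:R * sin x ^+ n * cos x) = n.+1%:R * sin x ^+ n * (1 - sin x ^+ 2).
  by rewrite -cs; ring.
rewrite !exprS -[n.+2]addn1 natrD; field.
have n0 := ler0n R n; rewrite gt_eqF//; lra.
Qed.

Lemma ger0_is_derive_le (R : realType) (f g : R -> R) (a b : R) : a <= b ->
  (forall x : R, is_derive x 1 f (g x)) -> (forall x, a < x < b -> 0 <= g x) ->
  f a <= f b.
Proof.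
move=> ab df g0.
apply: (@ger0_derive1_ndecr _ f a b) => //.
- by move=> x; rewrite in_itv/= => /g0; rewrite derive1E derive_val.
- apply: derivable_within_continuous => x _; exact: ex_derive.
Qed.

(** On [(0, pi / 2)] the powers of the sine decrease with the exponent, so the difference of the two
    antiderivatives is nondecreasing, and it starts from 0. *)
Lemma sin_int_le (R : realType) (n : nat) :
  sin_int n.+1 (pi / 2 : R) <= sin_int n (pi / 2 : R).
Proof.
have H0 k : sin_int k (0 : R) = 0.
  elim/ltn_ind: k => -[//|[_|k IH]] /=; first by rewrite cos0 subrr.
  have -> : sin_int k (0 : R) = 0 by apply: IH; rewrite ltnS ltnW.
  by rewrite mulr0 sin0 exprS !mul0r subrr mul0r.
rewrite -subr_ge0 -[X in X <= _](_ : sin_int n (0 : R) - sin_int n.+1 (0:R) = 0); last first.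
  by rewrite !H0 subrr.
apply: (@ger0_is_derive_le _ (fun y => sin_int n y - sin_int n.+1 y)
   (fun x => sin x ^+ n - sin x ^+ n.+1)).
- by rewrite divr_ge0 ?pi_ge0.
- move=> x; have D1 := @is_derive_sin_int R n x.
  have D2 := @is_derive_sin_int R n.+1 x; exact: is_deriveB.
- move=> x hx; have s0 : 0 <= sin x by rewrite ltW// sin_gt0_pihalf.
  by rewrite subr_ge0 exprS ler_piMl ?exprn_ge0 ?sin_le1.
Qed.

(** This is C(2n, n) / 4^n, the c_n of the overview. *)
Definition cbin (R : realType) (n : nat) : R := (n.*2)`!%:R / (4 ^+ n * n`!%:R ^+ 2).

Lemma cbin_gt0 (R : realType) (n : nat) : 0 < cbin R n.
Proof. by rewrite divr_gt0 ?mulr_gt0 ?exprn_gt0 ?ltr0n ?fact_gt0. Qed.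

Lemma cbinS (R : realType) (n : nat) :
  cbin R n.+1 = (2 * n%:R + 1) / (2 * n%:R + 2) * cbin R n.
Proof.
have f0 k : k`!%:R != 0 :> R by rewrite pnatr_eq0 -lt0n fact_gt0.
have n0 := ler0n R n.
rewrite /cbin doubleS !factS !natrM exprS -(addn1 n.*2.+1) -(addn1 n.*2) -(addn1 n).
rewrite !natrD -mul2n natrM; field.
rewrite f0 expf_neq0 ?pnatr_eq0//=; apply/andP; split; rewrite gt_eqF//; lra.
Qed.

(** At [pi / 2] the boundary term of the reduction formula vanishes, which leaves a two-step
    recursion with the same ratio as [cbinS]. *)
Lemma sin_int_pihalf (R : realType) (n : nat) :
  sin_int n.*2 (pi / 2) = cbin R n * (pi / 2) /\
  sin_int n.*2.+1 (pi / 2) = ((2 * n%:R + 1) * cbin R n)^-1.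
Proof.
elim: n => [|n [IH0 IH1]].
  rewrite /= cos_pihalf /cbin double0 fact0 expr0 expr1n !mulr1 divr1 mulr0 add0r mulr1.
  by rewrite mul1r subr0 invr1.
have c0 := cbin_gt0 R n; have n0 := ler0n R n.
have E m : sin_int m.+2 (pi / 2 : R) = m.+1%:R / m.+2%:R * sin_int m (pi / 2).
  by rewrite /= cos_pihalf mulr0 subr0 mulrAC.
have D k : (n.*2 + k)%:R = 2 * n%:R + k%:R :> R by rewrite natrD -mul2n natrM.
rewrite doubleS !E IH0 IH1 cbinS -[n.*2.+3]addn3 -[n.*2.+2]addn2 -[n.*2.+1]addn1 -(addn1 n).
rewrite !D natrD.
split; field; rewrite ?(gt_eqF c0) ?gt_eqF//=; try lra.
all: apply/andP; split; rewrite gt_eqF//; lra.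
Qed.

(** Comparison of the Wallis integrals of exponents 2n+1 and 2n. *)
Lemma wallis_lower (R : realType) (n : nat) :
  2 / pi <= cbin R n ^+ 2 * (2 * n%:R + 1).
Proof.
have [E0 E1] := sin_int_pihalf R n; have := sin_int_le R n.*2.
have c0 := cbin_gt0 R n; have n0 := ler0n R n; have p0 := pi_gt0 R.
have d0 : 0 < (2 * n%:R + 1) * cbin R n by rewrite mulr_gt0//; lra.
rewrite E0 E1 -[leLHS]div1r ler_pdivrMr// ler_pdivrMr// => H; lra.
Qed.

(** Comparison of the Wallis integrals of exponents 2n+2 and 2n+1; the last factor is
    (2n+2)/(2n+1). *)
Lemma wallis_upper (R : realType) (n : nat) :
  cbin R n ^+ 2 * (2 * n%:R + 1) <= 2 / pi * (1 + n.*2.+1%:R^-1).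
Proof.
have [E0 _] := sin_int_pihalf R n.+1; have [_ E1] := sin_int_pihalf R n.
have := sin_int_le R n.*2.+1.
have c0 := cbin_gt0 R n; have n0 := ler0n R n; have p0 := pi_gt0 R.
have d0 : 0 < (2 * n%:R + 1) * cbin R n by rewrite mulr_gt0//; lra.
rewrite -doubleS E0 E1 cbinS -[leRHS]div1r ler_pdivlMr//.
rewrite natr_doubleS.
move=> H; rewrite [leRHS]mulrAC ler_pdivlMr//.
have E : 2 * (1 + (2 * n%:R + 1)^-1) = 2 * (2 * n%:R + 2) / (2 * n%:R + 1) :> R.
  by field; rewrite gt_eqF//; lra.
rewrite E ler_pdivlMr; last lra.
have {}H : cbin R n ^+ 2 * (2 * n%:R + 1) ^+ 2 * pi / (2 * (2 * n%:R + 2)) <= 1.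
  by apply: le_trans H; rewrite le_eqVlt; apply/orP; left; apply/eqP; field; rewrite gt_eqF//; lra.
by move: H; rewrite ler_pdivrMr ?mul1r => [H|]; lra.
Qed.

Lemma cvg_wallis (R : realType) :
  cbin R n ^+ 2 * (2 * n%:R + 1) @[n --> \oo] --> (2 / pi : R).
Proof.
apply: (@squeeze_cvgr _ _ _ _ (fun=> 2 / pi)
  (fun n => 2 / pi * (1 + n.*2.+1%:R^-1))); last 2 first.
- exact: cvg_cst.
- rewrite -[X in _ --> X]mulr1; apply: cvgM; first exact: cvg_cst.
  rewrite -[X in _ --> X]addr0; apply: cvgD; first exact: cvg_cst.
  have D : (fun n : nat => n.*2) @ \oo --> \oo.
    by under eq_fun do rewrite -muln2; exact: cvg_mulnr.
  exact: (cvg_comp _ _ D (@cvg_harmonic R)).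
- by apply: nearW => n; rewrite wallis_lower wallis_upper.
Qed.

(** A rational form of the upper Wallis bound, from 2/pi <= 1 and 1 + 1/(2n+1) <= 2. *)
Lemma cbin_sqr_le (R : realType) (n : nat) : cbin R n ^+ 2 <= 2 / (2 * n%:R + 1).
Proof.
have n0 := ler0n R n.
rewrite ler_pdivlMr; last lra.
apply: le_trans (wallis_upper R n) _.
have : n.*2.+1%:R^-1 <= (1 : R) by rewrite invf_le1 ?ler1n.
have : 2 / pi <= (1 : R) by rewrite ler_pdivrMr ?pi_gt0// mul1r pi_ge2.
have : 0 < 2 / pi :> R by rewrite divr_gt0 ?pi_gt0.
set x := 2 / pi; set y := _^-1 => *; nra.
Qed.

(** * Dirichlet and Fejer kernels; the finite sine identity *)

Lemma dirichlet_kernel {R : realType} (b : R) (x : nat) :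
  sin b * (1 + 2 * \sum_(l < x) cos (2 * l.+1%:R * b)) = sin ((2 * x%:R + 1) * b).
Proof.
elim: x => [|x IH]; first by rewrite big_ord0 !mulr0 addr0 add0r mul1r mulr1.
rewrite big_ord_recr/= !mulrDr addrA -mulrDr IH.
have -> : (2 * x%:R + 1) * b = 2 * x.+1%:R * b - b by rewrite -addn1 natrD; ring.
have -> : (2 * x.+1%:R + 1) * b = 2 * x.+1%:R * b + b by ring.
by rewrite sinB sinD; ring.
Qed.

Lemma sin_natmul_pi (R : realType) (n : nat) : sin (n%:R * pi : R) = 0.
Proof.
elim: n => [|n IH]; first by rewrite mul0r sin0.
by rewrite -addn1 natrD mulrDl mul1r sinDpi IH oppr0.
Qed.

(** For b = l pi / N with N = 2M+1, the right side of the Dirichlet formula is sin(l pi) = 0, while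
    sin b > 0 because 0 < l < N. *)
Lemma sum_cos_odd (R : realType) (M l : nat) : (0 < l < M.*2.+1)%N ->
  \sum_(k < M) cos (2 * k.+1%:R * (l%:R * pi / M.*2.+1%:R)) = - 2^-1 :> R.
Proof.
move=> /andP[l0 lN]; set b := l%:R * pi / _.
have N0 : 0 < M.*2.+1%:R :> R by [].
have sb : 0 < sin b.
  apply: sin_gt0_pi; rewrite divr_gt0 ?mulr_gt0 ?pi_gt0 ?ltr0n//=.
  by rewrite ltr_pdivrMr// mulrC ltr_pM2l ?pi_gt0// ltr_nat.
have := dirichlet_kernel b M.
rewrite -natr_doubleS [in RHS]mulrC [in RHS]divfK ?gt_eqF// sin_natmul_pi => /eqP.
by rewrite mulf_eq0 (gt_eqF sb)/= => /eqP H; lra.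
Qed.

Lemma fejer_kernel {R : realType} (b : R) (x : nat) :
  sin (x%:R * b) ^+ 2 =
  sin b ^+ 2 * \sum_(y < x) (1 + 2 * \sum_(l < y) cos (2 * l.+1%:R * b)).
Proof.
elim: x => [|x IH]; first by rewrite mul0r sin0 big_ord0 expr0n mulr0.
rewrite big_ord_recr/= mulrDr -IH exprS expr1 -mulrA dirichlet_kernel.
(* With u = (x+1)b and v = xb, the increment is sin(u-v) sin(u+v) = sin^2 u - sin^2 v. *)
have -> : (2 * x%:R + 1) * b = x%:R * b + x.+1%:R * b by rewrite -addn1 natrD; ring.
have -> : sin b = sin (x.+1%:R * b - x%:R * b) by congr sin; rewrite -addn1 natrD; ring.
rewrite sinB sinD.
set s := sin (x.+1%:R * b); set c := cos (x.+1%:R * b).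
set s' := sin (x%:R * b); set c' := cos (x%:R * b).
transitivity (s' ^+ 2 + (s ^+ 2 * c' ^+ 2 - c ^+ 2 * s' ^+ 2)); last by ring.
by rewrite /c /c' !cos2sin2 -/s -/s'; ring.
Qed.

(** After division by sin^2, the sum over [k] is taken first: each cosine sum is -1/2, so the [y]-th
    kernel contributes M - y, and these add up over y < x. *)
Lemma sum_fejer_kernel (R : realType) (M x : nat) : (x <= M.*2.+1)%N ->
  \sum_(k < M) (sin (x%:R * (k.+1%:R * pi / M.*2.+1%:R)) /
               sin (k.+1%:R * pi / M.*2.+1%:R)) ^+ 2
  = x%:R * (M.*2.+1%:R - x%:R) / 2 :> R.
Proof.
move=> xN.
have sb (k : 'I_M) : sin (k.+1%:R * pi / M.*2.+1%:R) != 0 :> R.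
  have kN : (k.+1 < M.*2.+1)%N by have := ltn_ord k; lia.
  rewrite gt_eqF// sin_gt0_pi// divr_gt0 ?mulr_gt0 ?pi_gt0//=.
  by rewrite ltr_pdivrMr// mulrC ltr_pM2l ?pi_gt0// ltr_nat.
under eq_bigr => k _ do
  rewrite expr_div_n fejer_kernel mulrC mulrA mulVf ?expf_neq0// mul1r.
rewrite exchange_big/=.
have E (y : 'I_x) : \sum_(k < M)
    (1 + 2 * \sum_(l < y) cos (2 * l.+1%:R * (k.+1%:R * pi / M.*2.+1%:R))) = M%:R - y%:R :> R.
  rewrite big_split/= sumr_const card_ord; congr (_ + _).
  rewrite -mulr_sumr exchange_big/= (eq_bigr (fun=> - 2^-1)).
    by rewrite sumr_const card_ord -mulr_natr; lra.
  (* The angle is symmetric in the two indices, so [l.+1] takes the part of the fixed frequency; it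
     lies below N since l < y < x <= N. *)
  move=> l _; rewrite -[RHS](@sum_cos_odd R M l.+1).
    by apply: eq_bigr => k _; congr cos; ring.
  by have := ltn_ord l; have := ltn_ord y; lia.
rewrite (eq_bigr _ (fun y _ => E y)) {E sb xN}.
rewrite natr_doubleS.
elim: x => [|x IH]; first by rewrite big_ord0 !mul0r.
by rewrite big_ord_recr/= IH -addn1 natrD; field.
Qed.

(** * The sum of sin^2(kt) / k^2 *)

(** The first two bounds squeeze N sin(c / N) to its limit c; the third serves as domination. *)
Lemma sin_bounds {R : realType} (t : R) : 0 <= t <= pi / 2 ->
  [/\ t * cos t <= sin t, sin t <= t & t / 2 <= sin t].
Proof.
have A (s : R) : 0 <= s <= pi / 2 -> s * cos s <= sin s.
  move=> /andP[s0 sp].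
  have := @ger0_is_derive_le R (fun y => sin y - y * cos y) (fun y => y * sin y) 0 s s0.
  rewrite sin0 mul0r subr0 subr_ge0; apply.
    by move=> x; apply: is_derive_eq; rewrite /GRing.scale/=; ring.
  move=> x /andP[x0 xs]; rewrite mulr_ge0 ?(ltW x0)// sin_ge0_pi// ltW//=.
  by have := pi_gt0 R; lra.
move=> tp; have /andP[t0 t1] := tp; split; first exact: A.
  have := @ger0_is_derive_le R (fun y => y - sin y) (fun y => 1 - cos y) 0 t t0.
  by rewrite sin0 subr0 subr_ge0; apply=> x _; rewrite subr_ge0 cos_le1.
(* [sin t = 2 sin (t/2) cos (t/2) >= t cos^2 (t/2) = t (1 + cos t) / 2] *)
have Ah : t / 2 * cos (t / 2) <= sin (t / 2) by apply: A; lra.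
have Et : t = (t / 2) *+ 2 by rewrite -mulr_natr divfK.
have ct : 0 <= cos t by apply: cos_ge0_pihalf; rewrite t1 andbT; lra.
have ch : 0 <= cos (t / 2) by apply: cos_ge0_pihalf; lra.
have Ec : cos t = cos (t / 2) ^+ 2 *+ 2 - 1 by rewrite [in LHS]Et cos_mulr2n.
rewrite [X in _ <= sin X]Et sin_mulr2n.
have : t / 2 * cos (t / 2) * cos (t / 2) <= sin (t / 2) * cos (t / 2) by rewrite ler_wpM2r.
have : 0 <= t * cos t by rewrite mulr_ge0.
by rewrite Ec; lra.
Qed.

Lemma cvg_divr_natS (R : realType) (c : R) : c / M.*2.+1%:R @[M --> \oo] --> (0 : R).
Proof.
rewrite -[X in _ --> X](mulr0 c); apply: cvgM; first exact: cvg_cst.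
have D : (fun n : nat => n.*2) @ \oo --> \oo.
  by under eq_fun do rewrite -muln2; exact: cvg_mulnr.
exact: (cvg_comp _ _ D (@cvg_harmonic R)).
Qed.

(** Puts the majorant 1/k^2 into the telescoped form that [cvg_sum_telescoping_dominated] asks
    for. *)
Lemma invr_sqr_telescope (R : realType) (k : nat) :
  (k.+1%:R ^+ 2)^-1 <= 2 * (k.+1%:R^-1 - k.+2%:R^-1) :> R.
Proof.
have k0 := ler0n R k.
rewrite -addn2 -addn1 !natrD -subr_ge0.
rewrite (_ : _ - _ = k%:R / ((k%:R + 1) ^+ 2 * (k%:R + 2))).
  by rewrite divr_ge0// mulr_ge0 ?exprn_ge0//; lra.
by field; rewrite !gt_eqF//; lra.
Qed.

Lemma cvg_natmul_sin (R : realType) (j : nat) :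
  M.*2.+1%:R * sin (j%:R * pi / M.*2.+1%:R) @[M --> \oo] --> (j%:R * pi : R).
Proof.
have tcv := @cvg_divr_natS R (j%:R * pi).
apply: (@squeeze_cvgr _ _ _ _ (fun M => j%:R * pi * cos (j%:R * pi / M.*2.+1%:R))
  (fun=> j%:R * pi)); last 2 first.
- rewrite [X in _ --> X](_ : _ = j%:R * pi * cos 0); last by rewrite cos0 mulr1.
  apply: cvgM; first exact: cvg_cst.
  exact: (cvg_comp _ _ tcv (@continuous_cos R 0)).
- exact: cvg_cst.
near=> M.
have N0 : 0 < M.*2.+1%:R :> R by [].
have p0 := pi_gt0 R.
have jM : (j <= M)%N by near: M; exact: nbhs_infty_ge.
have [] := @sin_bounds R (j%:R * pi / M.*2.+1%:R).
  rewrite divr_ge0 ?mulr_ge0 ?(ltW p0)//= ler_pdivrMr// mulrAC ler_pdivlMr//.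
  rewrite -mulrA mulrC -mulrA ler_pM2l// -(natrM _ 2) ler_nat; lia.
move=> lo up _; rewrite -(ler_pM2l N0) in lo; rewrite -(ler_pM2l N0) in up.
have E : M.*2.+1%:R * (j%:R * pi / M.*2.+1%:R) = j%:R * pi :> R.
  by rewrite mulrC divfK// gt_eqF.
by rewrite mulrA E in lo; rewrite E in up; rewrite lo up.
Unshelve. all: by end_near. Qed.

Lemma cvg_truncn_div (R : realType) (c : R) : 0 <= c ->
  (Num.truncn (M.*2.+1%:R * c))%:R / M.*2.+1%:R @[M --> \oo] --> c.
Proof.
move=> c0; apply: (@squeeze_cvgr _ _ _ _ (fun M => c - 1 / M.*2.+1%:R) (fun=> c)).
- apply: nearW => M; have N0 : 0 < M.*2.+1%:R :> R by [].
  have /andP[lo up] := truncn_itv (mulr_ge0 (ltW N0) c0).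
  rewrite ler_pdivrMr// [c * _]mulrC lo andbT ler_pdivlMr// mulrBl divfK ?gt_eqF//.
  by rewrite [c * _]mulrC lerBlDr natr1 ltW.
- rewrite -[X in _ --> X]subr0; apply: cvgB; first exact: cvg_cst.
  exact: cvg_divr_natS.
- exact: cvg_cst.
Qed.

Lemma cvg_sum_sin_sqr (R : realType) (t : R) : 0 <= t <= pi ->
  \sum_(k < M) (sin (k.+1%:R * t) / k.+1%:R) ^+ 2 @[M --> \oo] --> t * (pi - t) / 2.
Proof.
move=> /andP[t0 tp]; have p0 := pi_gt0 R.
have p00 : pi != 0 :> R by rewrite gt_eqF.
pose x M := Num.truncn (M.*2.+1%:R * (t / pi)).
have tp0 : 0 <= t / pi by rewrite divr_ge0 ?(ltW p0).
have xcv : (x M)%:R / M.*2.+1%:R @[M --> \oo] --> t / pi by exact: cvg_truncn_div.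
have xN M : (x M <= M.*2.+1)%N.
  rewrite -(ler_nat R); apply: le_trans (_ : M.*2.+1%:R * (t / pi) <= _).
    by rewrite truncn_le mulr_ge0.
  by rewrite ler_piMr// ler_pdivrMr// mul1r.
pose b M k : R := k.+1%:R * pi / M.*2.+1%:R.
(* [f] is the term of the finite identity divided by N^2, and [g] is its limit for fixed [k], which
   is the wanted term divided by pi^2. *)
pose f M k := (sin ((x M)%:R * b M k) / (M.*2.+1%:R * sin (b M k))) ^+ 2.
pose g k : R := (sin (k.+1%:R * t) / (k.+1%:R * pi)) ^+ 2.
have fcv : \sum_(k < M) f M k @[M --> \oo] --> t / pi * (1 - t / pi) / 2.
  have E M : \sum_(k < M) f M k =
      (x M)%:R / M.*2.+1%:R * (1 - (x M)%:R / M.*2.+1%:R) / 2.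
    have N0 : M.*2.+1%:R != 0 :> R by rewrite pnatr_eq0.
    transitivity ((x M)%:R * (M.*2.+1%:R - (x M)%:R) / 2 / M.*2.+1%:R ^+ 2 : R); last by field.
    rewrite -sum_fejer_kernel// mulr_suml; apply: eq_bigr => k _.
    by rewrite /f !expr_div_n exprMn invfM mulrCA mulrC.
  under eq_fun do rewrite E.
  apply: cvgM; last exact: cvg_cst.
  by apply: cvgM => //; apply: cvgB => //; exact: cvg_cst.
have hcv : \sum_(k < M) (f M k - g k) @[M --> \oo] --> (0 : R).
  apply: (@cvg_sum_telescoping_dominated _ (fun M k => f M k - g k)
    (fun k => 4 * k.+1%:R^-1) id).
  - by move=> k; rewrite mulr_ge0.
  - by rewrite -[X in _ --> X](mulr0 4); apply: cvgM; [exact: cvg_cst|exact: cvg_harmonic].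
  - move=> M k kM.
    have N0 : 0 < M.*2.+1%:R :> R by [].
    have k0 : 0 < k.+1%:R :> R by [].
    have p2 := pi_ge2 R.
    have bp : 0 <= b M k <= pi / 2.
      rewrite /b divr_ge0 ?mulr_ge0 ?(ltW p0)//= ler_pdivrMr// mulrAC ler_pdivlMr//.
      rewrite -mulrA mulrC -mulrA ler_pM2l// -(natrM _ 2) ler_nat; lia.
    have [_ _ sb] := sin_bounds _ bp.
    (* From sin b >= b/2 and pi >= 2. Both denominators are then at least k+1, so [f] and [g] lie
       between 0 and 1/(k+1)^2. *)
    have Ns : k.+1%:R <= M.*2.+1%:R * sin (b M k).
      apply: (@le_trans _ _ (M.*2.+1%:R * (b M k / 2))); last by rewrite ler_pM2l.
      rewrite (_ : _ * _ = k.+1%:R * pi / 2); first by nra.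
      by rewrite /b; field; rewrite gt_eqF.
    have kp : k.+1%:R <= k.+1%:R * pi :> R by rewrite ler_peMr; lra.
    have B (s d : R) : k.+1%:R <= d -> 0 <= (sin s / d) ^+ 2 <= (k.+1%:R ^+ 2)^-1.
      move=> kd; have d0 : 0 < d by exact: lt_le_trans kd.
      rewrite sqr_ge0/= expr_div_n -[leRHS]mul1r ler_pM ?invr_ge0 ?sqr_ge0//.
      by rewrite lef_pV2 ?posrE ?exprn_gt0// lerXn2r ?nnegrE// ltW.
    have := B ((x M)%:R * b M k) _ Ns; rewrite -/(f M k).
    have := B (k.+1%:R * t) _ kp; rewrite -/(g k).
    have := invr_sqr_telescope R k.
    move: (f M k) (g k) (k.+1%:R ^+ 2)^-1 k.+1%:R^-1 k.+2%:R^-1 => F G K K1 K2 H1 H2 H3.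
    by rewrite ler_norml; lra.
  - move=> k; rewrite -[X in _ --> X](subrr (g k)); apply: cvgB; last exact: cvg_cst.
    have e1 : (fun M => (x M)%:R * b M k) @ \oo --> k.+1%:R * t.
      rewrite (_ : (fun M => _) = (fun M => k.+1%:R * pi * ((x M)%:R / M.*2.+1%:R))).
        rewrite (_ : k.+1%:R * t = k.+1%:R * pi * (t / pi)); last by rewrite -mulrA [pi * _]mulrC divfK.
        by apply: cvgM => //; exact: cvg_cst.
      by apply/funext => M; rewrite /b; ring.
    apply: (cvg_comp _ (fun y : R => y ^+ 2) _ (@exprn_continuous R 2 _)).
    apply: cvgM; first exact: (cvg_comp _ _ e1 (@continuous_sin R _)).
    by apply: cvgV; [rewrite mulf_neq0 ?pnatr_eq0|exact: cvg_natmul_sin].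
have E M : \sum_(k < M) (sin (k.+1%:R * t) / k.+1%:R) ^+ 2 =
    pi ^+ 2 * (\sum_(k < M) f M k - \sum_(k < M) (f M k - g k)).
  rewrite -sumrB mulr_sumr; apply: eq_bigr => k _.
  by rewrite subKr /g -exprMn invfM [pi * _]mulrC -mulrA divfK.
under eq_fun do rewrite E.
rewrite (_ : t * _ / 2 = pi ^+ 2 * (t / pi * (1 - t / pi) / 2 - 0)).
  by apply: cvgM; [exact: cvg_cst|exact: cvgB].
by rewrite subr0; move: (pi : R) p00 => p p00; field.
Qed.

(** * Associated Legendre functions at 0 *)

Lemma coef_sqrX_sub1_exp (R : realType) (n b : nat) : (b <= n)%N ->
  (('X ^+ 2 - 1 : {poly R}) ^+ n)`_b.*2 = (-1) ^+ (n - b) *+ 'C(n, b).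
Proof.
move=> bn; rewrite addrC exprDn coef_sum.
have E (i : 'I_n.+1) : ((- 1 : {poly R}) ^+ (n - i) * ('X ^+ 2) ^+ i *+ 'C(n, i))`_b.*2 =
    if i == b :> nat then (-1) ^+ (n - b) *+ 'C(n, b) else 0.
  rewrite -exprM coefMn -polyC1 -polyCN -polyC_exp coefCM coefXn.
  rewrite (_ : (b.*2 == 2 * i)%N = (i == b :> nat)); last by lia.
  by case: eqP => [->|_]; rewrite ?mulr1// mulr0 mul0rn.
rewrite (eq_bigr _ (fun i _ => E i)) -big_mkcond/= (big_pred1 (inord b)) => [//|i].
by rewrite /= -val_eqE/= inordK.
Qed.

Lemma coef_sqrX_sub1_exp_odd (R : realType) (n m : nat) : odd m ->
  (('X ^+ 2 - 1 : {poly R}) ^+ n)`_m = 0.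
Proof.
move=> om; rewrite addrC exprDn coef_sum big1// => i _.
have mi : (m == 2 * i)%N = false by apply/negbTE; lia.
by rewrite -exprM coefMn -polyC1 -polyCN -polyC_exp coefCM coefXn mi mulr0 mul0rn.
Qed.

Lemma horner0_derivn (R : realType) (p : {poly R}) (d : nat) :
  (p^`(d)).[0] = p`_d * d`!%:R.
Proof. by rewrite horner_coef0 coef_derivn addn0 ffactnn mulr_natr. Qed.

Lemma legendrePn_pos0_odd (R : realType) (n k : nat) : odd (n + k) ->
  legendrePn_pos n k (0 : R) = 0.
Proof.
move=> onk; rewrite /legendrePn_pos /legendreP horner0_derivn coef_sqrX_sub1_exp_odd//.
by rewrite mul0r !mulr0.
Qed.

(** With n = a + b and k = b - a, the derivative has order n + k = 2b, and at 0 it is (2b)! times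
    the coefficient (-1)^a C(a+b, b). The normalization supplies (2a)! / (2b)!. *)
Lemma legendrePn_pos0_sqr (R : realType) (a b : nat) : (a <= b)%N ->
  legendrePn_pos (a + b) (b - a) (0 : R) ^+ 2 =
  (2 * (a + b)%:R + 1) / (4 * pi) * cbin R a * cbin R b.
Proof.
move=> ab; rewrite /legendrePn_pos /legendreP horner0_derivn.
have -> : (a + b + (b - a) = b.*2)%N by lia.
have -> : (a + b - (b - a) = a.*2)%N by lia.
rewrite coef_sqrX_sub1_exp ?leq_addl// addnK.
have p0 := pi_gt0 R; have n0 := ler0n R (a + b).
have f0 k : k`!%:R != 0 :> R by rewrite pnatr_eq0 -lt0n fact_gt0.
rewrite exprMn sqr_sqrtr; last first.
  by rewrite !mulr_ge0 ?invr_ge0// ?mulr_ge0 ?(ltW p0)//; lra.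
have C : 'C(a + b, b)%:R = (a + b)`!%:R / (b`!%:R * a`!%:R) :> R.
  have := bin_fact (leq_addl a b); rewrite addnK => <-.
  by rewrite !natrM mulfK// mulf_neq0.
have -> : (-1) ^+ a *+ 'C(a + b, b) = (-1) ^+ a * ((a + b)`!%:R / (b`!%:R * a`!%:R)) :> R.
  by rewrite -mulr_natr C.
rewrite expr0n/= subr0 sqrtr1 expr1n mulr1 /cbin.
have E4 k : 4 ^+ k = (2 ^+ k) ^+ 2 :> R by rewrite exprAC; congr (_ ^+ _); ring.
rewrite !E4 exprD.
have [s1 s2] : ((-1) ^+ a) ^+ 2 = 1 :> R /\ ((-1) ^+ (b - a)) ^+ 2 = 1 :> R by rewrite !sqrr_sign.
have [k1 k2] : 2 ^+ a != 0 :> R /\ 2 ^+ b != 0 :> R by rewrite !expf_neq0 ?pnatr_eq0.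
have p00 : pi != 0 :> R by rewrite gt_eqF.
(* Factorials, powers and signs become atoms for [field]; the signs enter only through their
   squares. *)
move: (f0 a) (f0 b) (f0 (a + b)%N) (f0 b.*2) k1 k2 s1 s2 p00.
move: a`!%:R b`!%:R (a + b)`!%:R b.*2`!%:R a.*2`!%:R (2 ^+ a) (2 ^+ b) ((-1) ^+ a)
  ((-1) ^+ (b - a)) (pi : R) => fa fb fab fb2 fa2 ka kb sa sb p
  fa0 fb0 fab0 fb20 ka0 kb0 s1 s2 p1.
rewrite (_ : (_ / _ * _) ^+ 2 = sb ^+ 2 * sa ^+ 2 * (fb2 / (ka * kb * fb * fa)) ^+ 2).
  by rewrite s1 s2; field; rewrite ?fa0 ?fb0 ?fab0 ?fb20 ?ka0 ?kb0 ?p1.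
by field; rewrite ?fa0 ?fb0 ?fab0 ?fb20 ?ka0 ?kb0 ?p1.
Qed.

(** * The singular values as weighted sums *)

(** The coefficient of s_j^2 in (2n+1)/4 * mu_n^2, in closed form. The parity test records the
    vanishing of the Legendre value and makes both halvings exact. *)
Definition arc_weight (R : realType) (n j : nat) : R :=
  if odd (n + j) then 0
  else pi / 2 * (2 * n%:R + 1) * (cbin R (n - j)./2 * cbin R (n + j)./2).

Lemma arc_weightE (R : realType) (n j : nat) : (j <= n)%N ->
  (2 * n%:R + 1) / 4 * (8 * pi ^+ 2 / (2 * n%:R + 1) * legendrePn_pos n j 0 ^+ 2)
  = arc_weight R n j.
Proof.
move=> jn; rewrite /arc_weight; case: ifP => [|/negbT] onj.
  by rewrite legendrePn_pos0_odd// expr0n !mulr0.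
have n0 := ler0n R n; have p0 := pi_gt0 R; have p00 : pi != 0 :> R by rewrite gt_eqF.
have [a [b [ab -> ->]]] : exists a b : nat, [/\ (a <= b)%N, n = (a + b)%N & j = (b - a)%N].
  by exists (n - j)./2, (n + j)./2; split; lia.
rewrite legendrePn_pos0_sqr//.
rewrite (_ : (a + b - (b - a))./2 = a); last by lia.
rewrite (_ : (a + b + (b - a))./2 = b); last by lia.
have := ler0n R (a + b); move: (a + b)%:R (pi : R) p00 (cbin R a) (cbin R b) => x p p1 c d x0.
by field; rewrite p1 gt_eqF//; lra.
Qed.

Lemma sum_centered (V : zmodType) (T : int -> V) (n : nat) :
  \sum_(0 <= i < (2 * n).+1) T (i%:Z - n%:Z)
  = T 0 + \sum_(k < n) (T k.+1%:Z + T (- k.+1%:Z)).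
Proof.
have n1 : (n <= (2 * n).+1)%N by lia.
rewrite (big_cat_nat (leq0n _) n1)/= big_split/= [RHS]addrA [RHS]addrC; congr (_ + _).
  rewrite big_nat_rev/= big_mkord; apply: eq_bigr => k _.
  by congr T; have := ltn_ord k; lia.
rewrite -[X in \sum_(X <= _ < _) _]add0n big_addn (_ : (2 * n).+1 - n = n.+1)%N; last by lia.
rewrite big_nat_recl//= add0n subrr big_mkord; congr (_ + _).
by apply: eq_bigr => k _; congr T; lia.
Qed.

(** The squared Legendre value and s_j^2 are both even in j, so the terms of j and -j merge into the
    factor 2. *)
Lemma mu_sqrE (R : realType) (n : nat) (psi : R) :
  (2 * n%:R + 1) / 4 * mu n psi ^+ 2 =
  arc_weight R n 0 * (2 * psi) ^+ 2 +
  2 * \sum_(k < n) arc_weight R n k.+1 * (2 * sin (k.+1%:R * psi) / k.+1%:R) ^+ 2.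
Proof.
have n0 := ler0n R n.
rewrite /mu sqr_sqrtr; last first.
  rewrite sumr_ge0// => i _; rewrite mulr_ge0 ?sqr_ge0// mulr_ge0 ?sqr_ge0//.
  by apply: divr_ge0; [exact: mulr_ge0 (sqr_ge0 _)|lra].
rewrite (sum_centered _ (fun j => 8 * pi ^+ 2 / (2 * n%:R + 1) *
  `|legendrePn n j (0 : R)| ^+ 2 * s_fun j psi ^+ 2)).
have sqrN (j : int) : `|legendrePn n j (0 : R)| ^+ 2 = legendrePn_pos n `|j|%N (0 : R) ^+ 2.
  by rewrite real_normK ?num_real// /legendrePn; case: ifP; rewrite // exprMn sqrr_sign mul1r.
rewrite mulrDr; congr (_ + _).
  by rewrite sqrN mulrA absz0 arc_weightE.
rewrite !mulr_sumr; apply: eq_bigr => k _.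
have sN : s_fun (- k.+1%:Z) psi ^+ 2 = s_fun k.+1%:Z psi ^+ 2 :> R.
  rewrite (_ : s_fun (- _) psi = 2 * sin (- k.+1%:R * psi) / - k.+1%:R)//.
  by rewrite mulNr sinN invrN !mulrN mulNr opprK.
rewrite !sqrN abszN sN absz_nat -(arc_weightE R n k.+1 (ltn_ord k)).
rewrite (_ : s_fun _ psi = 2 * sin (k.+1%:R * psi) / k.+1%:R)//.
by move: (_ ^+ 2) (_ ^+ 2) (8 * pi ^+ 2 / _) => x y z; ring.
Qed.

(** * Uniform bound and limit of the weights; exchange of limit and sum *)

Lemma arc_weight_ge0 (R : realType) (n j : nat) : 0 <= arc_weight R n j.
Proof.
rewrite /arc_weight; case: ifP => // _; have n0 := ler0n R n.
by rewrite !mulr_ge0 ?(ltW (cbin_gt0 _ _)) ?divr_ge0 ?pi_ge0//; lra.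
Qed.

(** Squaring brings in [cbin ^+ 2], the quantity that the Wallis estimates control. *)
Lemma arc_weight_sqrE (R : realType) (a b : nat) : (a <= b)%N ->
  arc_weight R (a + b) (b - a) ^+ 2 = (pi / 2) ^+ 2 * (2 * (a + b)%:R + 1) ^+ 2 *
    (cbin R a ^+ 2 * cbin R b ^+ 2).
Proof.
move=> ab; rewrite /arc_weight (_ : odd _ = false); last by apply/negbTE; lia.
rewrite (_ : (a + b - (b - a))./2 = a); last by lia.
rewrite (_ : (a + b + (b - a))./2 = b); last by lia.
by rewrite !exprMn.
Qed.

(** By [cbin_sqr_le] the squared weight is at most 16 (2n+1)^2 / ((2a+1)(2b+1)), where n = a + b and
    j = b - a. The order sqrt j is reached at j = n, that is a = 0. *)
Lemma arc_weight_le (R : realType) (n j : nat) : (0 < j <= n)%N ->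
  arc_weight R n j <= 12 * Num.sqrt j%:R.
Proof.
move=> /andP[j0 jn]; have [onj|/negbTE onj] := boolP (odd (n + j)).
  by rewrite /arc_weight onj mulr_ge0 ?sqrtr_ge0.
rewrite -(@ler_sqr _ _ _) ?nnegrE ?arc_weight_ge0 ?mulr_ge0 ?sqrtr_ge0//.
rewrite [leRHS]exprMn sqr_sqrtr//.
have [a [b [ab En Ej]]] : exists a b : nat, [/\ (a <= b)%N, n = (a + b)%N & j = (b - a)%N].
  by exists (n - j)./2, (n + j)./2; split; lia.
have ab' : (a < b)%N by lia.
rewrite {onj jn j0}En Ej arc_weight_sqrE// natrD natrB//.
have a0 := ler0n R a; have ba : a%:R + 1 <= b%:R :> R by rewrite natr1 ler_nat.
have ca := cbin_sqr_le R a; have cb := cbin_sqr_le R b.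
move: (cbin R a ^+ 2) (cbin R b ^+ 2) (sqr_ge0 (cbin R a)) (sqr_ge0 (cbin R b)) ca cb.
move: a%:R b%:R a0 ba => x y x0 xy c d c0 d0 cx dy.
have p4 : (pi / 2) ^+ 2 <= 4 :> R.
  by have := @pihalf_lt2 R; have := pihalf_ge1 R; move: (pi / 2) => q; nra.
have cd : c * d <= 4 / ((2 * x + 1) * (2 * y + 1)).
  apply: le_trans (ler_pM c0 d0 cx dy) _.
  by rewrite le_eqVlt; apply/orP; left; apply/eqP; field; rewrite !gt_eqF//; lra.
apply: (@le_trans _ _ (4 * (2 * (x + y) + 1) ^+ 2 * (4 / ((2 * x + 1) * (2 * y + 1))))).
  apply: ler_pM => //; first by rewrite mulr_ge0 ?sqr_ge0.
    exact: mulr_ge0.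
  by rewrite ler_wpM2r ?sqr_ge0.
rewrite mulrA ler_pdivrMr ?mulr_gt0//; try lra.
(* Since a < b, one may put b = a + 1 + z with z >= 0; the difference of the two sides then has only
   nonnegative coefficients. *)
have [z -> z0] : exists2 z, y = x + 1 + z & 0 <= z by exists (y - x - 1); lra.
rewrite -subr_ge0 (_ : _ - _ = 16 * (20 * x ^+ 2 + 48 * x + 18 + 92 * (x * z) + 33 * z +
  36 * (x ^+ 2 * z) + 36 * (x * z ^+ 2) + 14 * z ^+ 2)); last by ring.
by rewrite !(mulr_ge0, addr_ge0, exprn_ge0).
Qed.

(* Index shift [m = p + i] for [j = 2 i + e], so that [a = p] and [b = p + j]. *)
Lemma cvg_arc_weight (R : realType) (e j : nat) : (e <= 1)%N -> ~~ odd (e + j) ->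
  arc_weight R (2 * m + e) j @[m --> \oo] --> (2 : R).
Proof.
move=> e1 ej; pose i := j./2.
rewrite -(cvg_shiftn i).
have wcv : cbin R (p + j) ^+ 2 * (2 * (p + j)%:R + 1) @[p --> \oo] --> (2 / pi : R).
  exact: (cvg_comp _ _ (cvg_addnr j) (cvg_wallis R)).
(* With 2n+1 = 4p+2j+1, these are the ratios (2n+1)/(2a+1) and (2n+1)/(2b+1), which complete the
   Wallis products to the squared weight. Its limit is (pi/2)^2 (2/pi)^2 * 4 = 4. *)
have r1 : 2 + (2 * j%:R - 1) / p.*2.+1%:R @[p --> \oo] --> (2 : R).
  rewrite -[X in _ --> X]addr0; apply: cvgD; first exact: cvg_cst.
  exact: cvg_divr_natS.
have r2 : 2 - (2 * j%:R + 1) / (p + j).*2.+1%:R @[p --> \oo] --> (2 : R).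
  rewrite -[X in _ --> X]subr0; apply: cvgB; first exact: cvg_cst.
  exact: (cvg_comp _ _ (cvg_addnr j) (@cvg_divr_natS R _)).
have p0 := pi_gt0 R; have p00 : pi != 0 :> R by rewrite gt_eqF.
have E p : arc_weight R (2 * (p + i) + e) j = Num.sqrt ((pi / 2) ^+ 2 *
    (cbin R p ^+ 2 * (2 * p%:R + 1) * (cbin R (p + j) ^+ 2 * (2 * (p + j)%:R + 1))) *
    ((2 + (2 * j%:R - 1) / p.*2.+1%:R) * (2 - (2 * j%:R + 1) / (p + j).*2.+1%:R))).
  rewrite -[LHS]ger0_norm ?arc_weight_ge0// -sqrtr_sqr; congr Num.sqrt.
  rewrite [X in arc_weight _ X](_ : _ = (p + (p + j))%N); last by rewrite /i; lia.
  rewrite [X in arc_weight _ _ X](_ : _ = (p + j - p)%N); last by lia.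
  rewrite arc_weight_sqrE ?leq_addr// !natr_doubleS !natrD.
  have x0 := ler0n R p; have y0 := ler0n R j.
  move: (pi / 2) (cbin R p) (cbin R (p + j)) p%:R j%:R x0 y0 => q c d x y x0 y0.
  by field; rewrite !gt_eqF//; lra.
under eq_fun do rewrite /= E.
have H := cvgM (cvgM (cvg_cst ((pi / 2) ^+ 2)) (cvgM (cvg_wallis R) wcv)) (cvgM r1 r2).
have E2 : Num.sqrt ((pi / 2) ^+ 2 * (2 / pi * (2 / pi)) * (2 * 2)) = 2 :> R.
  rewrite (_ : _ * _ = 2 ^+ 2); first by rewrite sqrtr_sqr ger0_norm.
  by move: (pi : R) p00 => p p1; field.
by have := cvg_comp _ _ (H _ _ _ _ _) (@sqrt_continuous R _); rewrite E2; apply.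
Qed.

(* With [x = sqrt (k+1)] and [y = sqrt (k+2)] this is [1/x^3 <= 6 (1/x - 1/y)], which
   follows from [y^2 = x^2 + 1] and [y <= 2 x]. *)
Lemma sqrtr_telescope (R : realType) (k : nat) :
  Num.sqrt k.+1%:R / k.+1%:R ^+ 2 <=
  6 * ((Num.sqrt k.+1%:R)^-1 - (Num.sqrt k.+2%:R)^-1) :> R.
Proof.
have Ex : k.+1%:R = Num.sqrt k.+1%:R ^+ 2 :> R by rewrite sqr_sqrtr.
have Ey : Num.sqrt k.+2%:R ^+ 2 = Num.sqrt k.+1%:R ^+ 2 + 1 :> R by rewrite !sqr_sqrtr// natr1.
have x1 : 1 <= Num.sqrt k.+1%:R :> R by rewrite -[leLHS]sqrtr1 ler_wsqrtr// ler1n.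
have y0 : 0 <= Num.sqrt k.+2%:R :> R by exact: sqrtr_ge0.
rewrite [X in _ / X ^+ 2 <= _]Ex.
move: (Num.sqrt k.+1%:R) (Num.sqrt k.+2%:R) Ey x1 y0 => x y Ey x1 y0 {Ex}.
have y2x : y <= 2 * x by rewrite -ler_sqr ?nnegrE//; [rewrite Ey exprMn; nra|lra].
have yx : x < y by rewrite -ltr_sqr ?nnegrE//; [rewrite Ey; lra|lra].
rewrite -subr_ge0 (_ : _ - _ = (6 * x ^+ 2 * (y - x) * (x + y) - y * (x + y)) / (x ^+ 3 * y * (x + y))).
  apply: divr_ge0; last by rewrite !mulr_ge0 ?exprn_ge0//; lra.
  rewrite -mulrA (_ : (y - x) * (x + y) = 1); last first.
    by rewrite mulrC [x + y]addrC mulrC -subr_sqr Ey; ring.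
  by rewrite mulr1; nra.
by field; rewrite !gt_eqF//; lra.
Qed.

Lemma cvg_invr_sqrtS (R : realType) (c : R) :
  c * (Num.sqrt k.+1%:R)^-1 @[k --> \oo] --> (0 : R).
Proof.
rewrite -[X in _ --> X](mulr0 c); apply: cvgM; first exact: cvg_cst.
rewrite (_ : (fun k => _) = (fun k => Num.sqrt k.+1%:R^-1)); last first.
  by apply/funext => k; rewrite sqrtrV.
by have := cvg_comp _ _ (@cvg_harmonic R) (@sqrt_continuous R 0); rewrite sqrtr0.
Qed.

(** Allows each weight to be replaced by its limit, 2 or 0 according to parity, inside a sum whose
    length grows with m. *)
Lemma cvg_arc_sum (R : realType) (e : nat) (psi : R) : (e <= 1)%N ->
  \sum_(k < 2 * m + e) (arc_weight R (2 * m + e) k.+1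
      - (if odd (e + k.+1) then 0 else 2)) * (2 * sin (k.+1%:R * psi) / k.+1%:R) ^+ 2
    @[m --> \oo] --> (0 : R).
Proof.
move=> e1; apply: (@cvg_sum_telescoping_dominated _
  (fun m k => (arc_weight R (2 * m + e) k.+1 - (if odd (e + k.+1) then 0 else 2)) *
     (2 * sin (k.+1%:R * psi) / k.+1%:R) ^+ 2)
  (* 336 = 14 * 4 * 6: the weight error is at most 12 sqrt(k+1) + 2 <= 14 sqrt(k+1), the squared
     sine factor at most 4/(k+1)^2, and [sqrtr_telescope] gives the 6. *)
  (fun k => 336 * (Num.sqrt k.+1%:R)^-1) (fun m => 2 * m + e)%N).
- by move=> k; rewrite mulr_ge0 ?invr_ge0 ?sqrtr_ge0.
- exact: cvg_invr_sqrtS.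
- move=> m k kn; rewrite normrM.
  have k0 : 0 < k.+1%:R :> R by [].
  have q4 : `|(2 * sin (k.+1%:R * psi) / k.+1%:R) ^+ 2| <= 4 / k.+1%:R ^+ 2 :> R.
    rewrite ger0_norm ?sqr_ge0// expr_div_n ler_pM2r ?invr_gt0 ?exprn_gt0//.
    by rewrite exprMn sin2cos2; have := sqr_ge0 (cos (k.+1%:R * psi)); lra.
  have w14 : `|arc_weight R (2 * m + e) k.+1 - (if odd (e + k.+1) then 0 else 2)|
      <= 14 * Num.sqrt k.+1%:R.
    have x1 : 1 <= Num.sqrt k.+1%:R :> R by rewrite -[leLHS]sqrtr1 ler_wsqrtr// ler1n.
    have := arc_weight_le R (2 * m + e) k.+1 kn.
    have := arc_weight_ge0 R (2 * m + e) k.+1.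
    by case: ifP => _; rewrite ler_norml; lra.
  apply: le_trans (ler_pM (normr_ge0 _) (normr_ge0 _) w14 q4) _.
  have := sqrtr_telescope R k.
  rewrite [X in _ -> X <= _](_ : _ = 56 * (Num.sqrt k.+1%:R / k.+1%:R ^+ 2)).
    move: (Num.sqrt k.+1%:R / k.+1%:R ^+ 2) (Num.sqrt k.+1%:R)^-1 (Num.sqrt k.+2%:R)^-1.
    by move=> F A B; lra.
  by field; rewrite gt_eqF.
- move=> k; have [oek|/negP/negP oek] := ifP.
    rewrite (_ : (fun m => _) = cst 0); first exact: cvg_cst.
    apply/funext => m; rewrite /arc_weight ifT ?subr0 ?mul0r//.
    by move: oek; lia.
  rewrite -[X in _ --> X](mul0r ((2 * sin (k.+1%:R * psi) / k.+1%:R) ^+ 2)).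
  apply: cvgM; last exact: cvg_cst.
  rewrite -[X in _ --> X](subrr 2); apply: cvgB; last exact: cvg_cst.
  exact: cvg_arc_weight.
Qed.

(** * Series over even indices and the two limits *)

Lemma sum_even_indices (V : nmodType) (r : nat -> V) (m e : nat) : (e <= 1)%N ->
  \sum_(k < 2 * m + e) (if odd k.+1 then 0 else r k.+1) = \sum_(k < m) r (2 * k.+1)%N.
Proof.
move=> e1; elim: m => [|m IH].
  by rewrite big_ord0 muln0 add0n; case: e e1 => [|[|//]] _; rewrite ?big_ord0 ?big_ord1.
rewrite (_ : 2 * m.+1 + e = (2 * m + e).+2)%N; last by lia.
rewrite !big_ord_recr/= IH -addrA; congr (_ + _).
case: e e1 {IH} => [|[|//]] _; rewrite ?addn0 ?addn1 mul2n /= odd_double/=.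
  by rewrite add0r -doubleS mul2n.
by rewrite addr0 -doubleS mul2n.
Qed.

(** Beyond pi/2 the angle 2 psi leaves [0, pi]; shifting it by pi brings it back and changes k(2
    psi) by k pi, which preserves the squared sine. *)
Lemma cvg_sum_sin_sqr_double (R : realType) (psi : R) : 0 <= psi <= pi ->
  \sum_(k < m) (sin (k.+1%:R * (2 * psi)) / k.+1%:R) ^+ 2 @[m --> \oo] -->
  if psi <= pi / 2 then psi * (pi - 2 * psi) else (2 * psi - pi) * (pi - psi).
Proof.
move=> /andP[psi0 psip]; case: (lerP psi (pi / 2)) => h.
  rewrite (_ : psi * _ = 2 * psi * (pi - 2 * psi) / 2); last by field.
  by apply: cvg_sum_sin_sqr; lra.
rewrite (_ : (2 * psi - pi) * _ = (2 * psi - pi) * (pi - (2 * psi - pi)) / 2); last by field.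
have E m : \sum_(k < m) (sin (k.+1%:R * (2 * psi)) / k.+1%:R) ^+ 2 =
    \sum_(k < m) (sin (k.+1%:R * (2 * psi - pi)) / k.+1%:R) ^+ 2.
  apply: eq_bigr => k _; rewrite !expr_div_n; congr (_ / _).
  rewrite [in RHS]mulrBr sinB sin_natmul_pi mulr0 subr0 exprMn [cos _ ^+ 2]cos2sin2.
  by rewrite sin_natmul_pi expr0n subr0 mulr1.
under eq_fun do rewrite E.
by apply: cvg_sum_sin_sqr; lra.
Qed.

Theorem theorem5 (R : realType) (psi : R) (hpsi0 : 0 <= psi) (hpsipi : psi <= pi) :
  ((fun m : nat => ( (4 * m%:R - 1) / 4 * mu ((2 * m).-1) psi ^+ 2: R)) @ \oo -->
     ((if psi <= pi / 2 then 4 * pi * psi else 4 * pi ^+ 2 - 4 * pi * psi) : R))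
  /\
  ((fun m : nat => ( (4 * m%:R + 1) / 4 * mu (2 * m) psi ^+ 2: R)) @ \oo -->
     ((if psi <= pi / 2 then 4 * pi * psi else 12 * pi * psi - 4 * pi ^+ 2) : R)).
Proof.
have psi0p : 0 <= psi <= pi by rewrite hpsi0.
pose q k : R := (2 * sin (k.+1%:R * psi) / k.+1%:R) ^+ 2.
pose w e k : R := if odd (e + k.+1) then 0 else 2.
pose F : R := if psi <= pi / 2 then psi * (pi - 2 * psi) else (2 * psi - pi) * (pi - psi).
have Fcv := cvg_sum_sin_sqr_double R psi psi0p; rewrite -/F in Fcv.
have qE k : q k = 4 * (sin (k.+1%:R * psi) / k.+1%:R) ^+ 2 by rewrite /q; ring.
(* At index 2(k+1) the factor 2 of s_j cancels against the denominator, leaving the series at angle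
   2 psi. As [q] counts from zero, index j is [q j.-1]. *)
have evenE m e : (e <= 1)%N -> \sum_(k < 2 * m + e) (if odd k.+1 then 0 else q k) =
    \sum_(k < m) (sin (k.+1%:R * (2 * psi)) / k.+1%:R) ^+ 2.
  move=> e1; rewrite (@sum_even_indices _ (fun j => q j.-1) m e e1).
  apply: eq_bigr => k _; rewrite /q prednK ?muln_gt0// natrM; congr (_ ^+ 2).
  rewrite [2 * k.+1%:R * psi]mulrAC [2 * psi * _]mulrC.
  by move: (sin _) => s; field; rewrite addrC natr1 pnatr_eq0.
(* Both parities at once, for degree n = 2m + e with 2n+1 = 4m + 2e + 1. The weight of j = 0
   survives only for even degree. *)
have limE e (l : R) : (e <= 1)%N ->
    \sum_(k < 2 * m + e) w e k * q k @[m --> \oo] --> l ->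
    (4 * m%:R + (2 * e%:R + 1)) / 4 * mu (2 * m + e) psi ^+ 2 @[m --> \oo] -->
      (if odd e then 0 else 2) * (2 * psi) ^+ 2 + 2 * l.
  move=> e1 lcv.
  have w0 : arc_weight R (2 * m + e) 0 @[m --> \oo] --> ((if odd e then 0 else 2) : R).
    have [oe|oe] := ifP.
      rewrite (_ : (fun m => _) = cst 0); first exact: cvg_cst.
      by apply/funext => m; rewrite /arc_weight ifT//; move: oe; lia.
    by apply: cvg_arc_weight => //; rewrite addn0 oe.
  have H := cvgD (cvgM w0 (cvg_cst ((2 * psi) ^+ 2)))
    (cvgM (cvg_cst (2 : R)) (cvgD (cvg_arc_sum R e psi e1) lcv)).
  rewrite -[l]add0r.
  rewrite (_ : (fun m => _) = (fun m => arc_weight R (2 * m + e) 0 * (2 * psi) ^+ 2 +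
    2 * (\sum_(k < 2 * m + e) (arc_weight R (2 * m + e) k.+1 - w e k) * q k +
         \sum_(k < 2 * m + e) w e k * q k))); first exact: H.
  apply/funext => m; rewrite -big_split/=.
  under eq_bigr do rewrite mulrBl subrK.
  by rewrite -mu_sqrE natrD natrM; congr (_ / _ * _); ring.
split.
(* The shift replaces 2m-1 by 2m+1 and avoids the truncated predecessor at m = 0. *)
- rewrite -cvg_shiftS.
  (* Odd indices are all indices minus the even ones; 8 is the weight 2 times the factor 4 of
     [qE]. *)
  have lcv : \sum_(k < 2 * m + 1) w 1 k * q k @[m --> \oo] -->
      8 * (psi * (pi - psi) / 2) - 2 * F.
    have S1 : \sum_(k < 2 * m + 1) (sin (k.+1%:R * psi) / k.+1%:R) ^+ 2 @[m --> \oo] -->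
        psi * (pi - psi) / 2.
      have D : (fun m => 2 * m + 1)%N @ \oo --> \oo.
        exact: (cvg_comp _ _ (@cvg_mulnl 2 isT) (cvg_addnr 1)).
      exact: (cvg_comp _ _ D (cvg_sum_sin_sqr R psi psi0p)).
    rewrite (_ : (fun m => _) = (fun m =>
       8 * \sum_(k < 2 * m + 1) (sin (k.+1%:R * psi) / k.+1%:R) ^+ 2 -
       2 * \sum_(k < m) (sin (k.+1%:R * (2 * psi)) / k.+1%:R) ^+ 2)).
      by apply: cvgB; apply: cvgM => //; exact: cvg_cst.
    apply/funext => m; rewrite -(evenE m 1%N)// !mulr_sumr -sumrB; apply: eq_bigr => k _.
    rewrite /w qE (_ : odd (1 + k.+1) = ~~ odd k.+1)//; move: ((_ / _) ^+ 2) => y.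
    by case: (odd k.+1) => /=; ring.
  have := limE 1%N _ isT lcv.
  rewrite (_ : _ + _ = if psi <= pi / 2 then 4 * pi * psi else 4 * pi ^+ 2 - 4 * pi * psi).
    have E m : (4 * m.+1%:R - 1) / 4 * mu (2 * m.+1).-1 psi ^+ 2 =
        (4 * m%:R + (2 * 1%:R + 1)) / 4 * mu (2 * m + 1) psi ^+ 2.
      rewrite (_ : (2 * m.+1).-1 = 2 * m + 1)%N; last by lia.
      by rewrite -[m.+1%:R]natr1; congr (_ / _ * _); ring.
    by rewrite -(funext E : (fun m => _) = _).
  by rewrite /= mul0r add0r /F; case: ifP => _; field.
- have lcv : \sum_(k < 2 * m + 0) w 0 k * q k @[m --> \oo] --> 2 * F.
    rewrite (_ : (fun m => _) = (fun m =>
       2 * \sum_(k < m) (sin (k.+1%:R * (2 * psi)) / k.+1%:R) ^+ 2)).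
      by apply: cvgM => //; exact: cvg_cst.
    apply/funext => m; rewrite -(evenE m 0%N)// mulr_sumr; apply: eq_bigr => k _.
    by rewrite /w add0n; case: odd; rewrite ?mul0r ?mulr0.
  have := limE 0%N _ isT lcv.
  rewrite (_ : _ + _ = if psi <= pi / 2 then 4 * pi * psi else 12 * pi * psi - 4 * pi ^+ 2).
    by under eq_fun do rewrite addn0 mulr0 add0r.
  (* The term of j = 0 contributes 8 psi^2, which cancels the quadratic part of 4 F in both
     cases. *)
  by rewrite /= /F; case: ifP => _; ring.
Qed.
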